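(* There is no nearly free line arrangement in $\mathbb{P}^2$ (over $\mathbb{C}$) with exponents $(d_1,d_2)$ such that $d_1=1$.
   Context: Let $S=\mathbb{C}[x,y,z]$ with its standard grading. A line arrangement of $d$ lines in $\mathbb{P}^2$ is a curve $f=0$ where $f\in S$ is a product of $d$ pairwise non-proportional linear forms. With partial derivatives $f_x,f_y,f_z$, let $AR(f)=\{(a,b,c)\in S^3 : af_x+bf_y+cf_z=0\}$ be the graded $S$-module of Jacobian syzygies; a homogeneous syzygy has degree $m$ if $a,b,c$ are homogeneous of degree $m$. The arrangement (or, more generally, a reduced curve $f=0$ of degree $d$) is nearly free with exponents $(d_1,d_2)$, $d_1\le d_2$, if $d_1+d_2=d$ and $AR(f)$ is minimally generated as a graded $S$-module by three homogeneous syzygies, of degrees $d_1, d_2, d_2$. *)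

(* Defs.v *)
From mathcomp Require Import all_boot all_order all_algebra.
From mathcomp Require Import complex mpoly reals.

Set Implicit Arguments.
Unset Strict Implicit.
Unset Printing Implicit Defensive.

Import GRing.Theory.
Local Open Scope ring_scope.

(* The linear forms must be nonzero: [0] is 1-homogeneous in [mpoly], and the
   non-proportionality clause says nothing when [d = 1]. *)
Definition line_arrangement (K : fieldType) (d : nat) (f : {mpoly K[3]}) :
    Prop :=
  exists l : 'I_d -> {mpoly K[3]},
    [/\ forall i, l i != 0 /\ l i \is 1.-homog,
        forall i j, i != j -> forall c : K, l i <> c *: l j
      & f = \prod_(i < d) l i].

(* A triple (a, b, c) in S^3 is a row vector, so that [*:] is the S-module
   structure of S^3. *)
Definition AR (K : fieldType) (f : {mpoly K[3]}) :
    {pred 'rV[{mpoly K[3]}]_3} :=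
  [pred r : 'rV_3 | \sum_(i < 3) r 0 i * f^`M(i) == 0].

Definition homog_triple (K : fieldType) (m : nat) (r : 'rV[{mpoly K[3]}]_3) :
    Prop :=
  forall i, r 0 i \is m.-homog.

Definition generates_AR (K : fieldType) (f : {mpoly K[3]}) (n : nat)
    (rho : 'I_n -> 'rV[{mpoly K[3]}]_3) (J : {set 'I_n}) : Prop :=
  (forall i, i \in J -> rho i \in AR f) /\
  (forall r, r \in AR f ->
     exists c : 'I_n -> {mpoly K[3]}, r = \sum_(i in J) c i *: rho i).

Definition minimally_generates_AR (K : fieldType) (f : {mpoly K[3]}) (n : nat)
    (rho : 'I_n -> 'rV[{mpoly K[3]}]_3) : Prop :=
  generates_AR f rho [set: 'I_n] /\
  (forall J : {set 'I_n}, generates_AR f rho J -> J = [set: 'I_n]).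

(* [(msize f).-1] is the total degree of [f]. Reducedness of the curve [f = 0]
   is left to the user of the predicate; it holds for line arrangements. *)
Definition nearly_free (K : fieldType) (f : {mpoly K[3]}) (d1 d2 : nat) :
    Prop :=
  [/\ (d1 <= d2)%N, (d1 + d2)%N = (msize f).-1
    & exists rho : 'I_3 -> 'rV[{mpoly K[3]}]_3,
        minimally_generates_AR f rho /\
        (forall i : 'I_3, homog_triple (if i == ord0 then d1 else d2) (rho i))].

(* Main.v *)
Require Import Defs.
From mathcomp Require Import all_boot all_order all_algebra.
From mathcomp Require Import complex mpoly reals.
From mathcomp Require Import ring.

(** Write [D_r] for the derivation attached to a triple [r].  Since all
    generators have positive degree, there is no nonzero constant syzygy.
    Some line [l] has [D_(rho 0) l != 0]: otherwise the partial derivatives of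
    [rho 0] are constant triples killing every line, hence constant syzygies,
    and [rho 0 = 0].  Put [f = l g] and let [theta] be the cross product of the
    gradients of [l] and [g].  It is a syzygy of degree [d - 2 < d2] killing [l],
    so [theta = c rho 0], and [D_theta l = 0] forces [c = 0], i.e. [theta = 0].
    Then the constant triples [e_k x grad l] kill both [l] and [g], so they are
    constant syzygies of [f]; hence [grad l = 0] and [l = 0]. *)

Set Implicit Arguments.
Unset Strict Implicit.
Unset Printing Implicit Defensive.

Import GRing.Theory.
Local Open Scope ring_scope.

Section HomogeneousPolynomials.
Variables (n : nat) (K : fieldType).
Implicit Types (p c : {mpoly K[n]}) (i j : 'I_n) (k m : nat).

(** Split [c] into homogeneous components: only the one of degree [d] with [d + m = k] contributes.
    The test [m <= k] guards against [k - m] truncating to 0, which would select the constant term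
    of [c]. *)
Lemma pihomog_mulr k m c p : p \is m.-homog ->
  pihomog mdeg k (c * p) =
  (if (m <= k)%N then pihomog mdeg (k - m) c else 0) * p.
Proof.
move=> hp; have hc := pihomog_partitionE (leqnn (msize c)).
have -> : (if (m <= k)%N then pihomog mdeg (k - m) c else 0) =
    \sum_(d < msize c) if (d + m == k)%N then pihomog mdeg d c else 0.
  case: leqP => hmk; last first.
    rewrite big1 // => d _; case: eqP => // hd.
    by move: hmk; rewrite -hd ltnNge leq_addl.
  rewrite {1}hc linear_sum; apply: eq_bigr => d _ /=.
  have hd := pihomogP mdeg d c.
  case: eqP => [<- | /eqP ne]; first by rewrite addnK pihomog_dE.
  apply: pihomog_ne0 hd; apply: contra ne => /eqP ->.
  by rewrite subnK.
rewrite {1}hc mulr_suml mulr_suml linear_sum; apply: eq_bigr => d _ /=.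
have hd := dhomogM (pihomogP mdeg d c) hp.
case: eqP => [<- | /eqP ne]; first by rewrite pihomog_dE.
by rewrite mul0r (pihomog_ne0 ne hd).
Qed.

Lemma dhomog_mderiv i m p : p \is m.+1.-homog -> p^`M(i) \is m.-homog.
Proof.
move=> hp; apply/dhomogP => mm; rewrite mcoeff_msupp mcoeff_mderiv => nz.
apply/eqP; apply: contraR nz => ne.
by rewrite (dhomog_nemf_coeff hp) ?mul0rn //= mdegD mdeg1 addn1 eqSS.
Qed.

Lemma mderiv_dhomog0 i p : p \is 0.-homog -> p^`M(i) = 0.
Proof.
move=> hp; apply/mpolyP => mm; rewrite mcoeff_mderiv mcoeff0.
by rewrite (dhomog_nemf_coeff hp) ?mul0rn //= mdegD mdeg1 addn1.
Qed.

(** The coefficients of a linear form are exactly its partial derivatives, with no integer factor,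
    so the characteristic does not matter. *)
Lemma dhomog1_mderiv_eq0 p :
  p \is 1.-homog -> (forall i, p^`M(i) = 0) -> p = 0.
Proof.
move=> hp dp0; apply/mpolyP => mm; rewrite mcoeff0.
have [/mdeg1P [i /eqP ->] | ne] := boolP (mdeg mm == 1%N); last first.
  exact: dhomog_nemf_coeff hp ne.
have := mcoeff_mderiv i p 0%MM.
by rewrite dp0 mcoeff0 add0m mnm0E mulr1n => <-.
Qed.

Lemma dhomog1_prod (I : finType) (A : pred I) (l : I -> {mpoly K[n]}) :
  (forall x, A x -> l x \is 1.-homog) -> \prod_(x | A x) l x \is #|A|.-homog.
Proof.
move=> hl; rewrite -sum1_card.
elim/big_rec2: _ => [|i p k Ai hk]; first exact: dhomog1.
exact: dhomogM (hl _ Ai) hk.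
Qed.

End HomogeneousPolynomials.

Section Derivations.
Variable K : fieldType.
Local Notation S := {mpoly K[3]}.
Implicit Types (f g p q : S) (r : 'rV[S]_3).

Definition derivation r p : S := \sum_(i < 3) r 0 i * p^`M(i).

Lemma derivationM r p q :
  derivation r (p * q) = derivation r p * q + p * derivation r q.
Proof.
rewrite /derivation mulr_suml mulr_sumr -big_split; apply: eq_bigr => i _.
by rewrite mderivM /=; ring.
Qed.

Lemma derivationZ c r p : derivation (c *: r) p = c * derivation r p.
Proof.
by rewrite /derivation mulr_sumr; apply: eq_bigr => i _; rewrite mxE mulrA.
Qed.

Lemma derivation_prod_eq0 (I : finType) (l : I -> S) r :
  (forall i, derivation r (l i) = 0) -> derivation r (\prod_i l i) = 0.
Proof.
move=> h; elim/big_rec: _ => [|i p _ hp].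
  by rewrite /derivation big1 // => i _; rewrite -mpolyC1 mderivC mulr0.
by rewrite derivationM h hp mul0r mulr0 addr0.
Qed.

Definition triple (a b c : S) : 'rV[S]_3 :=
  \row_i (if i == 0 then a else if i == 1 then b else c).

Lemma derivation_triple a b c p :
  derivation (triple a b c) p = a * p^`M(0) + b * p^`M(1) + c * p^`M(2%:R).
Proof.
rewrite /derivation !big_ord_recl big_ord0 addr0 addrA !mxE /=.
by do ![congr (_ + _)]; congr (_ * _^`M( _ )); apply: val_inj.
Qed.

Definition gradient_cross p q : 'rV[S]_3 :=
  triple (p^`M(1) * q^`M(2%:R) - p^`M(2%:R) * q^`M(1))
         (p^`M(2%:R) * q^`M(0) - p^`M(0) * q^`M(2%:R))
         (p^`M(0) * q^`M(1) - p^`M(1) * q^`M(0)).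

Lemma gradient_cross_l p q : derivation (gradient_cross p q) p = 0.
Proof. by rewrite derivation_triple; ring. Qed.

Lemma gradient_cross_r p q : derivation (gradient_cross p q) q = 0.
Proof. by rewrite derivation_triple; ring. Qed.

Lemma homog_gradient_cross m p q :
  p \is 1.-homog -> q \is m.+1.-homog -> homog_triple m (gradient_cross p q).
Proof.
move=> hp hq i; rewrite mxE; have h j k : p^`M(j) * q^`M(k) \is m.-homog.
  exact: dhomogM (dhomog_mderiv j hp) (dhomog_mderiv k hq).
by case: ifP => _; [|case: ifP => _]; rewrite rpredB ?h.
Qed.

Lemma gradient_cross_linear_eq0 p q : p \is 1.-homog ->
  gradient_cross p q = 0 ->
  (forall r, homog_triple 0 r -> r \in AR (p * q) -> r = 0) -> p = 0.
Proof.
move=> hp cr0 const0.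
have cr i := congr1 (fun r : 'rV[S]_3 => r 0 i) cr0.
have := cr 0; rewrite !mxE /= => c0.
have := cr 2%:R; rewrite !mxE /= => c2.
have h0 i : p^`M(i) \is 0.-homog := dhomog_mderiv i hp.
have kill a b c : a \is 0.-homog -> b \is 0.-homog -> c \is 0.-homog ->
    derivation (triple a b c) p = 0 -> derivation (triple a b c) q = 0 ->
    triple a b c = 0.
  move=> ha hb hc dp dq; apply: const0 => [i|].
    by rewrite mxE; case: ifP => _; [|case: ifP].
  by rewrite inE -/(derivation _ _) derivationM dp dq mul0r mulr0 addr0.
(* Up to sign, [t0] and [t1] come from crossing the third and first basis vectors with the gradient
   of [p]. Applied to [q] they give minus the entries [c2] and [c0] of the vanishing cross product,
   and together they contain all three partial derivatives of [p]. *)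
have t0 : triple (p^`M(1)) (- p^`M(0)) 0 = 0.
  apply: kill; rewrite ?rpredN ?dhomog0 ?h0 // derivation_triple; first by ring.
  by rewrite -[RHS]oppr0 -[in RHS]c2; ring.
have t1 : triple 0 (p^`M(2%:R)) (- p^`M(1)) = 0.
  apply: kill; rewrite ?rpredN ?dhomog0 ?h0 // derivation_triple; first by ring.
  by rewrite -[RHS]oppr0 -[in RHS]c0; ring.
apply: dhomog1_mderiv_eq0 hp _.
have e0 := congr1 (fun r : 'rV[S]_3 => r 0 0) t0.
have e1 := congr1 (fun r : 'rV[S]_3 => r 0 1) t0.
have e2 := congr1 (fun r : 'rV[S]_3 => r 0 1) t1.
move: e0 e1 e2; rewrite !mxE /= => e0 /eqP e1 e2; rewrite oppr_eq0 in e1.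
move=> i; case: i => [[|[|[|//]]] hi].
- by rewrite -(eqP e1); congr (_^`M( _ )); apply: val_inj.
- by rewrite -e0; congr (_^`M( _ )); apply: val_inj.
- by rewrite -e2; congr (_^`M( _ )); apply: val_inj.
Qed.

(** Take the degree [k] component of each coordinate: a generator of degree above [k] would need a
    coefficient of negative degree, so it drops out. *)
Lemma homog_component_combination k (J : finType) (dg : J -> nat)
    (rho : J -> 'rV[S]_3) (c : J -> S) r :
  (forall j, homog_triple (dg j) (rho j)) -> homog_triple k r ->
  r = \sum_j c j *: rho j ->
  exists c' : J -> S, r = \sum_(j | (dg j <= k)%N) c' j *: rho j.
Proof.
move=> hrho hr def_r; exists (fun j => pihomog mdeg (k - dg j) (c j)).
apply/rowP => i; rewrite -(pihomog_dE (hr i)) {1}def_r !summxE linear_sum /=.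
rewrite [RHS]big_mkcond; apply: eq_bigr => j _.
rewrite mxE (pihomog_mulr _ _ (hrho j i)).
by case: ifP => _; rewrite ?mxE ?mul0r.
Qed.

End Derivations.

Lemma nearly_free_product_neq1 (K : fieldType) (d d1 d2 : nat)
    (l : 'I_d -> {mpoly K[3]}) :
  (forall i, l i != 0 /\ l i \is 1.-homog) ->
  nearly_free (\prod_i l i) d1 d2 -> d1 <> 1%N.
Proof.
move=> hl [le12 sum12 [rho [[[rhoAR gen] minimal] hdeg]]] d1E; subst d1.
set f := \prod_i l i in sum12 rhoAR gen minimal.
have lh i : l i \is 1.-homog by case: (hl i).
have fh : f \is d.-homog.
  by have := @dhomog1_prod 3 K 'I_d predT l (fun i _ => lh i); rewrite card_ord.
have f0 : f != 0 by apply/prodf_neq0 => i _; case: (hl i).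
have dE : d = d2.+1 by rewrite (dhomog_uniq f0 fh (dhomog_msize fh)) -sum12.
have low k r : homog_triple k r -> r \in AR f -> exists c : 'I_3 -> _,
    r = \sum_(i | ((if i == ord0 then 1%N else d2) <= k)%N) c i *: rho i.
  move=> hr /gen [c rE]; apply: (homog_component_combination (c := c) hdeg hr).
  by rewrite rE; apply: eq_bigl => i; rewrite inE.
have const0 r : homog_triple 0 r -> r \in AR f -> r = 0.
  move=> hr /(low _ _ hr) [c ->]; apply: big_pred0 => i; apply/negbTE.
  by case: ifP => //= _; rewrite -ltnNge.
have rho0 : rho ord0 != 0.
  (* A zero generator could be discarded, against minimality. *)
  apply/eqP => r0; suff /minimal/setP/(_ ord0) : generates_AR f rho [set~ ord0].
    by rewrite !inE eqxx.
  split=> [i _|r /gen [c rE]]; first by apply: rhoAR; rewrite inE.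
  exists c; rewrite rE (bigD1 ord0) ?inE //= r0 scaler0 add0r.
  by apply: eq_bigl => i; rewrite !inE.
have [i Di] : exists i, derivation (rho ord0) (l i) != 0.
  apply/existsP; apply: contraR rho0 => /existsPn D0; apply/eqP/rowP => k.
  rewrite mxE; apply: dhomog1_mderiv_eq0 => [|j]; first exact: hdeg ord0 k.
  (* The entries of [rho ord0] are linear because [d1 = 1], so [r] is constant. The partials of each
     line are constants, so differentiating [D0 i] shows that [r] kills that line too. *)
  pose r : 'rV[{mpoly K[3]}]_3 := \row_m (rho ord0 0 m)^`M(j).
  suff /rowP/(_ k) : r = 0 by rewrite !mxE.
  apply: const0 => [m|]; first by rewrite mxE dhomog_mderiv ?(hdeg ord0 m).
  rewrite inE -/(derivation _ _) derivation_prod_eq0 // => i.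
  have /negPn/eqP/(congr1 (mderiv j)) := D0 i.
  rewrite /derivation linear_sum linear0 => E. rewrite -[RHS]E; apply: eq_bigr => m _.
  rewrite mxE /= mderivM (mderiv_dhomog0 _ (dhomog_mderiv m (lh i))).
  by rewrite mulr0 addr0.
pose g := \prod_(j | j != i) l j.
have fE : f = l i * g by rewrite /f (bigD1 i).
have gh : g \is d2.-homog.
  have := @dhomog1_prod 3 K 'I_d (predC1 i) l (fun j _ => lh j).
  by have -> : #|predC1 i| = d2 by rewrite cardC1 card_ord dE.
(* Now [g] has degree [m.+1 = d2], so the cross product has degree [m], just below the other two
   generators. *)
case: d2 => [//|m] in le12 sum12 hdeg dE low gh *.
have crAR : gradient_cross (l i) g \in AR f.
  rewrite inE -/(derivation _ _) fE derivationM gradient_cross_l.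
  by rewrite gradient_cross_r mul0r mulr0 addr0.
have [c crE] := low _ _ (homog_gradient_cross (lh i) gh) crAR.
have [a aE] : exists a, gradient_cross (l i) g = a *: rho ord0.
  (* When [m = 0] not even [rho ord0] has low enough degree: the sum is empty and the coefficient
     must be 0. *)
  exists (if (1 <= m)%N then c ord0 else 0); rewrite crE big_mkcond.
  rewrite (bigD1 ord0) //= big1 ?addr0 => [|j /negbTE ->]; last by rewrite ltnn.
  by case: ifP => // _; rewrite scale0r.
have a0 : a = 0.
  have := gradient_cross_l (l i) g; rewrite aE derivationZ => /eqP.
  by rewrite mulf_eq0 (negbTE Di) orbF => /eqP.
have [/eqP[]] := hl i; apply: (gradient_cross_linear_eq0 (q := g)) => //.
  by rewrite aE a0 scale0r.
by rewrite -fE.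
Qed.

Theorem proposition3p5 (R : realType) :
  ~ exists (d : nat) (f : {mpoly R[i][3]}) (d1 d2 : nat),
      line_arrangement d f /\ nearly_free f d1 d2 /\ d1 = 1%N.
Proof.
move=> [d [f [d1 [d2 [[l [hl _ ->]] [nf]]]]]].
exact: nearly_free_product_neq1 hl nf.
Qed.
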